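(* Let $\mathcal{B}$ and $\mathcal{C}$ be uniform barriers on $\omega$ such that $\rho(\mathcal{B})\leq\rho(\mathcal{C})$. Then the following are equivalent: (1) $\mathsf{FIN}^{\mathcal{C}}\not\leq_K\mathcal{G}_c(\mathcal{B})$; (2) $\rho(\mathcal{B})<\rho(\mathcal{C})$.
   Context: For sets of naturals, $s\sqsubseteq t$ means $s$ is an initial segment of $t$. For $\mathcal{F}\subseteq[\omega]^{<\omega}$ and $M\subseteq\omega$ let $\mathcal{F}|M=\{s\in\mathcal{F}:s\subseteq M\}$. A barrier on an infinite set $M\subseteq\omega$ is a family $\mathcal{B}$ of finite subsets of $M$ such that (a) $s\subseteq t$ implies $s=t$ for $s,t\in\mathcal{B}$, and (b) every infinite $N\subseteq M$ has an initial segment $s\sqsubseteq N$ with $s\in\mathcal{B}$. For $n\in M$ put $\mathcal{B}(n)=\{t\in\mathcal{B}:\min t=n\}$ and $\mathcal{B}[n]=\{t\setminus\{n\}:t\in\mathcal{B}(n)\}$, which is a barrier on $M\setminus(n+1)$ when $\mathcal B\neq\{\emptyset\}$. Rank: $T(\mathcal{B})=\{s\in[\omega]^{<\omega}:\exists t\in\mathcal{B}\,(s\sqsubseteq t)\}$, $\rho_{T(\mathcal{B})}(s)=\sup\{\rho_{T(\mathcal{B})}(t)+1:t\in T(\mathcal{B}),\ s\sqsubseteq t,\ s\neq t\}$ (with $\sup\emptyset=0$), and $\rho(\mathcal{B})=\rho_{T(\mathcal{B})}(\emptyset)<\omega_1$. Uniform barriers, by recursion on rank: $\{\emptyset\}$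 (rank $0$) and $[M]^1$ (rank $1$) are uniform; a barrier $\mathcal{B}$ on $M$ of rank $\alpha>1$ is uniform if each $\mathcal{B}[n]$ ($n\in M$) is a uniform barrier on $M\setminus(n+1)$ and either $\alpha=\beta+1$ and $\rho_{T(\mathcal{B})}(\{n\})=\beta$ for all $n\in M$, or $\alpha$ is a limit and $\{\rho_{T(\mathcal{B})}(\{n\}):n\in M\}$ is an increasing sequence with limit $\alpha$. Ideals: for a barrier $\mathcal{B}$, $\mathsf{FIN}^{\mathcal{B}}$ is the ideal on $\mathcal{B}$ defined recursively: $\mathsf{FIN}^{\{\emptyset\}}=\{\emptyset\}$ (only the empty subset of $\{\emptyset\}$), and otherwise $X\subseteq\mathcal{B}$ is in $\mathsf{FIN}^{\mathcal{B}}$ iff the set of $n$ such that $\{s\setminus\{n\}:s\in X\cap\mathcal{B}(n)\}\notin\mathsf{FIN}^{\mathcal{B}[n]}$ is finite. $\mathcal{G}_c(\mathcal{B})$ is the ideal on $\mathcal{B}$ of all $S\subseteq\mathcal{B}$ for which there is no infinite $X\subseteq\omega$ with $\mathcal{B}|X\subseteq S$. Katětov order: for ideals $\mathcal{I}$ on $X$ and $\mathcal{J}$ on $Y$ ($X,Y$ countable), $\mathcal{I}\leq_K\mathcal{J}$ iff there is $f:Y\to X$ with $f^{-1}(A)\in\mathcal{J}$ for all $A\in\mathcal{I}$. *)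

(* Defs.v *)
From mathcomp Require Import all_boot finmap.
From mathcomp Require Import boolp classical_sets functions cardinality.

Set Implicit Arguments.
Unset Strict Implicit.
Unset Printing Implicit Defensive.

Local Open Scope classical_set_scope.

(* Ordinals as well-founded trees: [OSup f] denotes sup {f a + 1 : a}.
   Different trees may denote the same ordinal, so ordinals are compared with
   [ole], [olt] and [oeq], never with Leibniz equality. *)
Inductive Ord : Type := OSup (A : Type) (f : A -> Ord).

Fixpoint ole (x y : Ord) {struct x} : Prop :=
  match x, y with
  | OSup A f, OSup B g => forall a : A, exists b : B, ole (f a) (g b)
  end.

Definition olt (x y : Ord) : Prop :=
  match y with OSup B g => exists b : B, ole x (g b) end.

Definition oeq (x y : Ord) : Prop := ole x y /\ ole y x.

Definition ozero : Ord := OSup (fun e : Empty_set => match e with end).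

Definition osucc (x : Ord) : Ord := OSup (fun _ : unit => x).

Definition olimit (a : Ord) : Prop :=
  olt ozero a /\ forall b : Ord, olt b a -> olt (osucc b) a.

(* [initseg s N] is "s is an initial segment of N". *)
Definition initseg (s N : set nat) : Prop :=
  s `<=` N /\ forall x y : nat, s y -> N x -> x <= y -> s x.

Definition fsfamily := set {fset nat}.

Definition restr (F : fsfamily) (X : set nat) : fsfamily :=
  [set s | F s /\ [set` s] `<=` X].

(* [tail M n] is M \ (n+1). *)
Definition tail (M : set nat) (n : nat) : set nat := [set m | M m /\ n < m].

Definition is_min (s : {fset nat}) (n : nat) : Prop :=
  n \in s /\ forall m : nat, m \in s -> n <= m.

(* [min_at B n] is B(n) and [deriv B n] is B[n]. *)
Definition min_at (B : fsfamily) (n : nat) : fsfamily :=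
  [set t | B t /\ is_min t n].

Definition del (n : nat) (F : fsfamily) : fsfamily :=
  [set (t `\ n)%fset | t in F].

Definition deriv (B : fsfamily) (n : nat) : fsfamily := del n (min_at B n).

Definition barrier (M : set nat) (B : fsfamily) : Prop :=
  [/\ infinite_set M,
      forall s : {fset nat}, B s -> [set` s] `<=` M,
      forall s t : {fset nat}, B s -> B t -> (s `<=` t)%fset -> s = t &
      forall N : set nat, infinite_set N -> N `<=` M ->
        exists2 s : {fset nat}, B s & initseg [set` s] N].

Definition tree (B : fsfamily) : fsfamily :=
  [set s | exists2 t : {fset nat}, B t & initseg [set` s] [set` t]].

(* [below T t s]: t is a proper end-extension of s in T. *)
Definition below (T : fsfamily) (t s : {fset nat}) : Prop :=
  [/\ T t, initseg [set` s] [set` t] & s <> t].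

Fixpoint rank_acc (T : fsfamily) (s : {fset nat}) (h : Acc (below T) s)
    {struct h} : Ord :=
  OSup (fun p : {t : {fset nat} | below T t s} =>
    rank_acc (Acc_inv h (proj2_sig p))).

(* The rank of a node from which T has an infinite branch is irrelevant: the
   tree of a barrier is well-founded. *)
Definition node_rank (T : fsfamily) (s : {fset nat}) : Ord :=
  match pselect (Acc (below T) s) with
  | left h => rank_acc h
  | right _ => ozero
  end.

Definition rank (B : fsfamily) : Ord := node_rank (tree B) fset0.

(* The ranks r n, for n in M, strictly increase with n and have supremum a. *)
Definition increasing_to (M : set nat) (r : nat -> Ord) (a : Ord) : Prop :=
  [/\ forall m n : nat, M m -> M n -> m < n -> olt (r m) (r n),
      forall n : nat, M n -> ole (r n) a &
      forall b : Ord, olt b a -> exists2 n : nat, M n & olt b (r n)].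

Inductive uniform_barrier : set nat -> fsfamily -> Prop :=
| uniform_rank0 (M : set nat) :
    infinite_set M -> uniform_barrier M [set fset0]
| uniform_rank1 (M : set nat) :
    infinite_set M -> uniform_barrier M [set [fset n]%fset | n in M]
| uniform_step (M : set nat) (B : fsfamily) :
    barrier M B ->
    olt (osucc ozero) (rank B) ->
    (forall n : nat, M n -> uniform_barrier (tail M n) (deriv B n)) ->
    (exists2 b : Ord, oeq (rank B) (osucc b) &
       forall n : nat, M n -> oeq (node_rank (tree B) [fset n]%fset) b) \/
    (olimit (rank B) /\
       increasing_to M (fun n => node_rank (tree B) [fset n]%fset) (rank B)) ->
    uniform_barrier M B.

(* [is_FIN B I] is the graph of the recursion defining I = FIN^B.  When B is a
   barrier on M other than [set fset0], the n with B(n) nonempty are the elements of M. *)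
Inductive is_FIN : fsfamily -> set fsfamily -> Prop :=
| is_FIN0 : is_FIN [set fset0] [set set0]
| is_FIN_step (B : fsfamily) (J : nat -> set fsfamily) :
    B <> [set fset0] ->
    (forall n : nat, min_at B n !=set0 -> is_FIN (deriv B n) (J n)) ->
    is_FIN B [set X : fsfamily | X `<=` B /\
      finite_set [set n | min_at B n !=set0 /\
                          ~ J n (del n (X `&` min_at B n))]].

Definition FIN (B : fsfamily) : set fsfamily :=
  [set X | exists2 I : set fsfamily, is_FIN B I & I X].

Definition Gc (B : fsfamily) : set fsfamily :=
  [set S : fsfamily | S `<=` B /\
    ~ exists2 X : set nat, infinite_set X & restr B X `<=` S].

(* Katetov order between an ideal I on the set D and an ideal J on the set E;
   a map E -> D is a total function on the ambient types mapping E into D, so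
   preimages are intersected with E. *)
Definition katetov_le (T U : Type) (D : set T) (I : set (set T))
    (E : set U) (J : set (set U)) : Prop :=
  exists2 f : U -> T, set_fun E D f &
    forall A : set T, I A -> J (E `&` f @^-1` A).

(* Main.v *)
Require Import Defs.
From mathcomp Require Import all_boot finmap.
From mathcomp Require Import boolp classical_sets functions cardinality.

(** Write C[m] for the derived barrier at m. Uniformity enters only through
    this: if a < rank C, then a <= rank C[m] for all but finitely many m.

    If rank C <= rank B, send n to the largest m <= n with
    rank C[m] <= rank B[n] (this m tends to infinity with n) and map B[n] to
    C[m] recursively; no B|X then has an image in FIN^C.

    If rank B < rank C, let f : B -> C. By Nash-Williams and a fusion there is X
    such that, for each m, either f maps a whole B|(X \ (k+1)) into C(m), and
    then that image is in FIN^C, or min (f t) = m is impossible for t in B|X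
    beyond k. In the latter case each t with min (f t) = m extends one of the
    finitely many nonempty s contained in [0, k]. The part of B|X above such an s
    has rank < rank B <= rank C[m], so by induction its image can be made small
    in FIN^{C[m]}. *)

Set Implicit Arguments.
Unset Strict Implicit.
Unset Printing Implicit Defensive.

Local Open Scope classical_set_scope.

(** * Comparison of ordinals given as trees *)

Lemma ole_refl x : ole x x.
Proof. by elim: x => A f IH a; exists a; apply: IH. Qed.

Lemma ole_trans y x z : ole x y -> ole y z -> ole x z.
Proof.
elim: x y z => A f IH [B g] [D h] xy yz a.
have [b ab] := xy a; have [d bd] := yz b.
by exists d; apply: IH ab bd.
Qed.

Lemma olt_ole_trans y x z : olt x y -> ole y z -> olt x z.
Proof.
case: y z => B g [D h] [b xb] yz; have [d bd] := yz b.
by exists d; apply: ole_trans bd.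
Qed.

Lemma olt_ole x y : olt x y -> ole x y.
Proof.
elim: x y => A f IH [B g] [b xb] a; exists b; apply: IH.
by case: (g b) xb => D h; apply.
Qed.

(** Classical induction: if [f a] is at most no [g b], then every [g b] is strictly below [f a], so
    [y] is at most [f a]. *)
Lemma ole_total x y : ole x y \/ olt y x.
Proof.
elim: x y => A f IH [B g].
have [|/existsNP[a /forallNP na]] :=
  pselect (forall a, exists b, ole (f a) (g b)); first by left.
right; exists a.
suff K b : olt (g b) (f a).
  by case: (f a) K => D h K b; apply: K.
by case: (IH a (g b)) => // /na.
Qed.

Lemma oleP x y : (forall z, olt z x -> olt z y) -> ole x y.
Proof.
case: x y => A f [B g] h a; apply: (h (f a)).
by exists a; apply: ole_refl.
Qed.

Lemma olt_succ x y : olt x (osucc y) <-> ole x y.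
Proof. by split=> [[]|h] //; exists tt. Qed.

(** * Ranks of nodes in a well-founded tree *)

Lemma rank_acc_irr T s (h h' : Acc (below T) s) :
  ole (rank_acc h) (rank_acc h').
Proof.
move: s h h'; refine (fix IH s h h' {struct h} := _).
case: h => h; case: h' => h' /= p; exists p; exact: IH.
Qed.

Lemma olt_node_rank T s : Acc (below T) s -> forall x,
  olt x (node_rank T s) <-> exists2 t, below T t s & ole x (node_rank T t).
Proof.
move=> hs x; rewrite /node_rank; case: pselect => // h.
have sub t : below T t s -> Acc (below T) t by apply: Acc_inv.
case: h => h /=; split.
  move=> [[t ts] /= xt]; exists t => //.
  case: pselect => [h'|/(_ (sub t ts))//].
  exact: (ole_trans xt (rank_acc_irr _ _)).
move=> [t ts]; case: pselect => [h' xt|/(_ (sub t ts))//].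
exists (exist _ t ts) => /=; exact: (ole_trans xt (rank_acc_irr _ _)).
Qed.

(** * Infinite sets of naturals and fusion *)

Lemma infinite_natP (X : set nat) :
  infinite_set X <-> forall k, exists2 x, X x & k < x.
Proof.
split=> [infX k|h finX].
  apply: contrapT => /forall2NP H; apply: infX.
  apply: (@sub_finite_set _ _ `I_k.+1); last exact: finite_II.
  by move=> x Xx /=; rewrite ltnS; case: (H x) => // /negP; rewrite -leqNgt.
have [A XA] := finite_fsetP.1 finX.
have [x Xx] := h (\max_(a <- enum_fset A) a).
by rewrite ltnNge (@leq_bigmax_seq _ (enum_fset A) xpredT id x) //; move: Xx; rewrite XA.
Qed.

Lemma infinite_tail M n : infinite_set M -> infinite_set (tail M n).
Proof.
move=> /infinite_natP h; apply/infinite_natP => k.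
have [x Mx] := h (maxn k n); rewrite gtn_max => /andP[kx nx].
by exists x.
Qed.

(** Together with [dense] this says that [R] is open dense in the infinite sets of naturals ordered
    by inclusion. *)
Definition hereditary (R : set nat -> Prop) :=
  forall X Y, X `<=` Y -> R Y -> R X.

Definition dense (R : set nat -> Prop) :=
  forall M, infinite_set M -> exists X, [/\ infinite_set X, X `<=` M & R X].

Lemma dense_seq (I : eqType) (R : I -> set nat -> Prop) (l : seq I) :
  (forall i, hereditary (R i)) -> (forall i, i \in l -> dense (R i)) ->
  dense (fun X => forall i, i \in l -> R i X).
Proof.
move=> her; elim: l => [_ M iM|i l IH den M iM].
  by exists M; split.
have [|X [iX XM RX]] := IH _ M iM.
  by move=> j jl; apply: den; rewrite inE jl orbT.
have [|Y [iY YX RY]] := den i _ X iX; first by rewrite inE eqxx.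
exists Y; split=> // [|j]; first exact: subset_trans XM.
by rewrite inE => /orP[/eqP->//|/RX]; apply: her.
Qed.

(** Pick [x i] in [S i] and shrink the rest of [S i] to a set [S i.+1] satisfying [R (x i)]. The
    points [x i] form the required set: its tail after [x i] lies in [S i.+1], so heredity
    applies. *)
Lemma fusion (R : nat -> set nat -> Prop) :
  (forall n, hereditary (R n)) -> (forall n, dense (R n)) ->
  dense (fun X => forall n, X n -> R n (tail X n)).
Proof.
move=> her den M iM.
have /choice[F FP] : forall M, exists p : nat * set nat, infinite_set M ->
    [/\ M p.1, infinite_set p.2, p.2 `<=` tail M p.1 & R p.1 p.2].
  move=> N; have [iN|] := pselect (infinite_set N); last first.
    by move=> ?; exists (0, N).
  have [x Nx _] := (infinite_natP N).1 iN 0.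
  have [Y [iY YN RY]] := den x _ (@infinite_tail _ x iN).
  by exists (x, Y).
pose S i := iter i (fun N => (F N).2) M; pose x i := (F (S i)).1.
have iS i : infinite_set (S i).
  by elim: i => //= i /FP[].
have Sx i : S i (x i) by case: (FP _ (iS i)).
have SS i : S i.+1 `<=` tail (S i) (x i) by case: (FP _ (iS i)).
have Sle i j : i <= j -> S j `<=` S i.
  elim: j => [|j IH]; first by rewrite leqn0 => /eqP->.
  rewrite leq_eqVlt => /orP[/eqP->//|/IH ij].
  by apply: subset_trans ij => y /SS[].
have xlt i j : i < j -> x i < x j.
  by move=> ij; have /SS[] := Sle _ _ ij _ (Sx j).
exists (range x); split.
- apply/infinite_natP => k; exists (x k.+1) => //.
  suff K i : i <= x i by apply: leq_ltn_trans (K k) (xlt _ _ _).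
  by elim: i => // i IH; apply: leq_ltn_trans IH (xlt _ _ _).
- by move=> _ [i _ <-]; apply: (Sle 0 i).
- move=> _ [i _ <-]; have [_ _ _] := FP _ (iS i); apply: her.
  move=> _ [[j _ <-] ij]; apply: (Sle i.+1 j) => //.
  by rewrite ltnNge; apply/negP; rewrite leq_eqVlt => /orP[/eqP e|/xlt];
    [move: ij; rewrite e ltnn|rewrite ltnNge (ltnW ij)].
Qed.

(** * Initial segments and well-foundedness of the tree of a barrier *)

Lemma initseg_trans (s t N : set nat) :
  initseg s t -> initseg t N -> initseg s N.
Proof.
move=> [st hst] [tN htN]; split=> [x /st/tN //|x y sx Nx xy].
exact: (hst _ _ sx (htN _ _ (st _ sx) Nx xy) xy).
Qed.

Lemma barrier_thin M B s t : barrier M B -> B s -> B t ->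
  initseg [set` s] [set` t] -> s = t.
Proof.
by move=> [_ _ thin _] Bs Bt [st _]; apply: thin => //; apply/fsubsetP.
Qed.

Lemma below_card T t s : below T t s -> #|` s| < #|` t|.
Proof.
move=> [_ [st _] nst]; apply: fproper_ltn_card.
by rewrite fproperEneq; apply/andP; split; [apply/eqP|apply/fsubsetP].
Qed.

(* The nodes of an infinite branch would exhaust an infinite set, one of whose
   initial segments lies in the barrier. *)
Lemma barrier_wf M B s : barrier M B -> Acc (below (tree B)) s.
Proof.
move=> [_ BM thin bar]; apply: contrapT => nAs.
have /choice[F FP] : forall s, exists t, ~ Acc (below (tree B)) s ->
    below (tree B) t s /\ ~ Acc (below (tree B)) t.
  move=> u; apply: contrapT => /forallNP H.
  have [Au|nAu] := pselect (Acc (below (tree B)) u).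
    by apply: (H u).
  apply: nAu; constructor => t tu; apply: contrapT => nAt.
  by apply: (H t).
pose g i := iter i F s.
have nA i : ~ Acc (below (tree B)) (g i) by elim: i => //= i /FP[].
have gS i : below (tree B) (g i.+1) (g i) by case: (FP _ (nA i)).
have gle i j : i <= j -> initseg [set` g i] [set` g j].
  elim: j => [|j IH]; first by rewrite leqn0 => /eqP->; split.
  rewrite leq_eqVlt => /orP[/eqP->|/IH ij]; first by split.
  by apply: initseg_trans ij _; case: (gS j).
have cg i : i <= #|` g i|.
  by elim: i => // i IH; apply: leq_ltn_trans IH (below_card (gS i)).
pose N : set nat := [set x | exists i, x \in g i].
have gN i : initseg [set` g i] N.
  split=> [x|x y gx [j gy] xy]; first by exists i.
  have [ij|ji] := leqP i j; last by case: (gle _ _ (ltnW ji)) => + _; apply.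
  by case: (gle _ _ ij) => _ h; apply: h gx gy xy.
have NM : N `<=` M.
  move=> x [i xi]; case: (gS i) => [[t Bt [it _]] [ii _] _].
  by apply: (BM t) => //; apply: it; apply: ii.
have iN : infinite_set N.
  move=> /finite_fsetP[A NA].
  have : (g #|` A|.+1 `<=` A)%fset.
    apply/fsubsetP => x xg; have : N x by exists #|` A|.+1.
    by rewrite NA.
  by move=> /fsubset_leq_card; rewrite leqNgt cg.
(* The node of [g] whose index is one more than the size of [b] contains some [x] outside [b]. Both
   are initial segments of [N], so [b] lies inside this node and hence inside some [t] of [B];
   thinness gives [b = t], which contains [x]. *)
have [b Bb [bN hb]] := bar N iN NM.
case: (gS #|` b|) => [[t Bt [gt _]] _ _].
have := cg #|` b|.+1; rewrite ltnNge => /negP; apply.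
have [/fsubset_leq_card//|] := boolP (g #|` b|.+1 `<=` b)%fset.
move=> /fsubsetPn[x xg xb].
suff bg : (b `<=` g #|` b|.+1)%fset.
  have bt : b = t by apply: thin => //; apply: fsubset_trans bg _; apply/fsubsetP.
  by case/negP: xb; rewrite bt; apply: gt.
apply/fsubsetP => y yb; have [_ hg] := gN #|` b|.+1.
have [xy|yx] := leqP y x.
  by apply: (hg _ x) => //=; apply: bN.
case/negP: xb; apply: (hb x y) => //; last exact: ltnW.
by exists #|` b|.+1.
Qed.

(** * Cones of the tree and homogeneous sets *)

(** The stem [s] need not lie in [X], so [X] can shrink while the stem stays fixed. *)
Definition cone (B : fsfamily) (s : {fset nat}) (X : set nat) : fsfamily :=
  [set t | [/\ B t, initseg [set` s] [set` t] &
               forall x, x \in t -> x \in s \/ X x]].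

Lemma cone_sub B s X Y : X `<=` Y -> cone B s X `<=` cone B s Y.
Proof. by move=> XY t [Bt st tX]; split=> // x /tX[]; [left|right; apply: XY]. Qed.

Lemma cone0 B X : cone B fset0 X = restr B X.
Proof.
apply/seteqP; split=> t; first by move=> [Bt _ tX]; split=> // x /tX[].
by move=> [Bt tX]; split=> // x xt; right; apply: tX.
Qed.

Lemma initsegU (s t : {fset nat}) k : initseg [set` s] [set` t] ->
  initseg [set` (s `|` [fset x in t | x <= k])%fset] [set` t].
Proof.
move=> [st hst]; split=> [x|x y] /=.
  by rewrite in_fsetU !inE => /orP[/st//|/andP[]].
rewrite !in_fsetU !inE => /orP[sx yt xy|/andP[tx xk] yt yx].
  by rewrite (hst _ _ sx yt xy).
by rewrite yt (leq_trans yx xk) orbT.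
Qed.

Lemma mem_least (P : nat -> bool) x : P x ->
  exists2 n, P n & forall m, P m -> n <= m.
Proof.
move=> Px; have exP : exists n, P n by exists x.
by case: (ex_minnP exP) => n Pn nmin; exists n.
Qed.

(* Nash-Williams: every 2-colouring of a barrier is constant on some B|X;
   relativized to the nodes of the tree, for induction along the tree. *)
Lemma nash_williams M0 B s (P : {fset nat} -> Prop) : barrier M0 B ->
  dense (fun X => (forall t, cone B s X t -> P t) \/
                  (forall t, cone B s X t -> ~ P t)).
Proof.
move=> bB; elim: {s}(barrier_wf s bB) => s _ IH M iM.
have [Bs|nBs] := pselect (B s).
  exists M; split=> //; have [Ps|nPs] := pselect (P s); [left|right];
    by move=> t [Bt st _]; rewrite -(barrier_thin bB Bs Bt st).
(* The guard makes [R n] vacuous unless [n] lies beyond [s], so that it is dense for every [n]. *)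
pose R n X := (forall x, x \in s -> x < n) ->
  (forall t, cone B (n |` s)%fset X t -> P t) \/
  (forall t, cone B (n |` s)%fset X t -> ~ P t).
have herR n : hereditary (R n).
  move=> X Y XY RY sn; have [H|H] := RY sn; [left|right];
    by move=> t /(cone_sub XY)/H.
have denR n : dense (R n).
  move=> N iN; have [sn|nsn] := pselect (forall x, x \in s -> x < n); last first.
    by exists N; split.
  have [Tn|nTn] := pselect (tree B (n |` s)%fset); last first.
    by exists N; split=> // _; left=> t [Bt nt _]; case: nTn; exists t.
  have [|X [iX XN HX]] := IH (n |` s)%fset _ N iN; last by exists X; split.
  split=> //; last first.
    move=> sE; have /sn : n \in s by rewrite sE fset1U1.
    by rewrite ltnn.
  split=> x /=; first by rewrite in_fset1U orbC => ->.
  move=> y xs; rewrite in_fset1U => /orP[/eqP->|//].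
  by rewrite leqNgt sn.
(* Starting beyond the maximum of [s] discharges the guard of [R] at all points of [X]. *)
have [X [iX XM HX]] := fusion herR denR
  (infinite_tail (n := \max_(x <- enum_fset s) x) iM).
have sX n : X n -> forall x, x \in s -> x < n.
  move=> /XM[_ sn] x xs; apply: leq_ltn_trans sn.
  exact: (leq_bigmax_seq x).
(* Each point [n] of [X] gets the colour of the cone whose stem is [s] with [n] added; an infinite
   colour class is then homogeneous. *)
pose Q n := forall t, cone B (n |` s)%fset (tail X n) t -> P t.
(* As [s] is not in [B], each [t] in its cone has a least element [n] outside [s], and lies in the
   cone over [s] with [n] added. *)
have key Y (P' : {fset nat} -> Prop) : Y `<=` X ->
    (forall n, Y n -> forall t, cone B (n |` s)%fset (tail X n) t -> P' t) ->
    forall t, cone B s Y t -> P' t.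
  move=> YX HY t [Bt [st hst] tY].
  have /fsubsetPn[x xt xs] : ~~ (t `<=` s)%fset.
    apply/negP => ts; apply: nBs; suff -> : s = t by [].
    by apply/eqP; rewrite eqEfsubset ts andbT; apply/fsubsetP.
  have [|n /andP[nt ns] nmin] := @mem_least (fun x => (x \in t) && (x \notin s)) x.
    by rewrite xt.
  have Yn : Y n by case: (tY n nt) => // ns'; rewrite ns' in ns.
  apply: (HY n) => //; split=> //.
    split=> y /=; first by rewrite in_fset1U => /orP[/eqP->//|/st].
    move=> z; rewrite !in_fset1U => /orP[/eqP->|zs] yt yz; last first.
      by rewrite (hst _ _ zs yt yz) orbT.
    have [//|ys] := boolP (y \in s); rewrite ?orbT // orbF.
    by rewrite eqn_leq yz nmin // yt.
  move=> y yt; rewrite in_fset1U.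
  have [ys|ys] := boolP (y \in s); first by left; rewrite orbT.
  have := nmin y; rewrite yt ys leq_eqVlt => /(_ isT)/orP[/eqP->|ny].
    by left; rewrite eqxx.
  right; split=> //; apply: YX; case: (tY y yt) => // ys'.
  by rewrite ys' in ys.
have [fin|inf] := pselect (finite_set [set n | X n /\ Q n]).
  exists (X `\` [set n | X n /\ Q n]); split.
  - exact: infinite_setD.
  - by move=> n [/XM[]].
  - right; apply: key => [n []//|n [Xn nQ]].
    by case: (HX n Xn (sX n Xn)) => // Qn; case: nQ.
exists [set n | X n /\ Q n]; split=> //; first by move=> n [/XM[]].
by left; apply: key => n [].
Qed.

(** * Derived barriers and their ranks *)

Lemma is_min_cons n (t : {fset nat}) : (forall x, x \in t -> n < x) ->
  is_min (n |` t)%fset n /\ ((n |` t) `\ n)%fset = t.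
Proof.
move=> nt; split; first split; first exact: fset1U1.
  by move=> m; rewrite in_fset1U => /orP[/eqP->//|/nt/ltnW].
by apply: fsetU1K; apply/negP => /nt; rewrite ltnn.
Qed.

Lemma is_min_uncons n (t : {fset nat}) : is_min t n ->
  (n |` (t `\ n))%fset = t /\ forall x, x \in (t `\ n)%fset -> n < x.
Proof.
move=> [nt tn]; split; first exact: fsetD1K.
by move=> x; rewrite in_fsetD1 ltn_neqAle eq_sym => /andP[-> /tn].
Qed.

Lemma is_min_uniq t m n : is_min t m -> is_min t n -> m = n.
Proof.
by move=> [mt tm] [nt tn]; apply/eqP; rewrite eqn_leq tm // tn.
Qed.

Lemma is_min_ex t : t != fset0 -> exists n, is_min t n.
Proof.
move=> /fset0Pn[x xt]; have [n nt nmin] := @mem_least (mem t) x xt.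
by exists n; split.
Qed.

Lemma derivP B n t :
  deriv B n t <-> (forall x, x \in t -> n < x) /\ B (n |` t)%fset.
Proof.
split=> [[u [Bu /is_min_uncons[uE un]] <-]|[nt Bt]]; first by rewrite uE.
by have [mn E] := is_min_cons nt; exists (n |` t)%fset.
Qed.

Lemma initseg_cons n (s t : {fset nat}) :
    (forall x, x \in t -> n < x) ->
    initseg [set` s] [set` t] ->
  initseg [set` (n |` s)%fset] [set` (n |` t)%fset].
Proof.
move=> nt [st hst]; split=> [x|x y] /=.
  by rewrite !in_fset1U => /orP[->//|/st ->]; rewrite orbT.
rewrite !in_fset1U => /orP[/eqP->|ys].
  by move=> /orP[->//|/nt]; rewrite ltnNge => /negP.
move=> /orP[->//|xt xy].
by rewrite (hst _ _ ys xt xy) orbT.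
Qed.

Lemma initseg_uncons n (s t : {fset nat}) :
    (forall x, x \in s -> n < x) -> (forall x, x \in t -> n < x) ->
    initseg [set` (n |` s)%fset] [set` (n |` t)%fset] ->
  initseg [set` s] [set` t].
Proof.
move=> ns nt [st hst]; split=> [x xs|x y ys xt xy] /=.
  have : x \in (n |` t)%fset by apply: st; rewrite /= in_fset1U (xs : x \in s) orbT.
  by rewrite in_fset1U => /orP[/eqP xn|//]; have := ns _ xs; rewrite xn ltnn.
have : x \in (n |` s)%fset.
  by apply: hst xy; rewrite /= in_fset1U ?(ys : y \in s) ?(xt : x \in t) orbT.
by rewrite in_fset1U => /orP[/eqP xn|//]; have := nt _ xt; rewrite xn ltnn.
Qed.

Lemma initseg_cons_min n (s t : {fset nat}) : (forall x, x \in s -> n < x) ->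
  initseg [set` (n |` s)%fset] [set` t] -> is_min t n.
Proof.
move=> ns [st hst]; have nt : n \in t by apply: st; rewrite /= fset1U1.
split=> // m mt; rewrite leqNgt; apply/negP => mn.
have : m \in (n |` s)%fset.
  by apply: (hst _ n) => //=; [rewrite fset1U1|exact: ltnW].
rewrite in_fset1U => /orP[/eqP mE|/ns]; first by rewrite mE ltnn in mn.
by rewrite ltnNge (ltnW mn).
Qed.

Lemma tree_deriv_gt B n s x : tree (deriv B n) s -> x \in s -> n < x.
Proof. by move=> [t /derivP[nt _] [st _]] /st/nt. Qed.

Lemma tree_deriv B n s : (forall x, x \in s -> n < x) ->
  tree (deriv B n) s <-> tree B (n |` s)%fset.
Proof.
move=> ns; split=> [[t /derivP[nt Bt] st]|[t Bt st]].
  by exists (n |` t)%fset => //; apply: initseg_cons.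
have tn := initseg_cons_min ns st; exists (t `\ n)%fset; first by exists t.
have [tE nt] := is_min_uncons tn.
by apply: (initseg_uncons (n := n)) => //; rewrite tE.
Qed.

Lemma below_deriv B n s t :
    (forall x, x \in s -> n < x) -> (forall x, x \in t -> n < x) ->
  below (tree (deriv B n)) t s <-> below (tree B) (n |` t)%fset (n |` s)%fset.
Proof.
move=> ns nt; split=> [[Tt st nst]|[Tt st nst]]; split.
- exact/tree_deriv.
- exact: initseg_cons.
- move=> e; apply: nst.
  by rewrite -(is_min_cons ns).2 -(is_min_cons nt).2 e.
- exact/tree_deriv.
- exact: (initseg_uncons (n := n)).
- by move=> e; apply: nst; rewrite e.
Qed.

(** Adding [n] is an isomorphism from the tree of [deriv B n] onto the part of the tree of [B] from
    [[fset n]] upwards; induction along the tree transfers the ranks. *)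
Lemma node_rank_deriv M M' B n s : barrier M B -> barrier M' (deriv B n) ->
    (forall x, x \in s -> n < x) ->
  oeq (node_rank (tree (deriv B n)) s) (node_rank (tree B) (n |` s)%fset).
Proof.
move=> bB bD; elim: {s}(barrier_wf s bD) => s _ IH ns.
split; apply: oleP => z.
  move=> /(olt_node_rank (barrier_wf _ bD))[t ts zt].
  have nt x : x \in t -> n < x by case: ts => /tree_deriv_gt h _ _; apply: h.
  apply/(olt_node_rank (barrier_wf _ bB)); exists (n |` t)%fset.
    exact/below_deriv.
  by apply: ole_trans zt _; case: (IH t ts nt).
move=> /(olt_node_rank (barrier_wf _ bB))[u us zu].
have [uE nu] : (n |` (u `\ n))%fset = u /\ forall x, x \in (u `\ n)%fset -> n < x.
  by apply: is_min_uncons; case: us => _ /(initseg_cons_min ns).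
have us' : below (tree (deriv B n)) (u `\ n)%fset s by apply/below_deriv; rewrite ?uE.
apply/(olt_node_rank (barrier_wf _ bD)); exists (u `\ n)%fset => //.
by apply: ole_trans zu _; case: (IH _ us' nu) => _; rewrite uE.
Qed.

Lemma rank_deriv M M' B n : barrier M B -> barrier M' (deriv B n) ->
  oeq (rank (deriv B n)) (node_rank (tree B) [fset n]%fset).
Proof.
by move=> bB bD; have := node_rank_deriv (s := fset0) bB bD; rewrite fsetU0; apply.
Qed.

(** * Basic barriers and induction on uniform barriers *)

Lemma barrier_fset0 M : infinite_set M -> barrier M [set fset0].
Proof.
move=> iM; split=> // [s -> x //|s t -> -> //|N _ _].
by exists fset0 => //; split=> [x|x y].
Qed.

Lemma barrier_fset1 M : infinite_set M -> barrier M [set [fset n]%fset | n in M].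
Proof.
move=> iM; split=> // [_ [n Mn <-] x|_ _ [m _ <-] [n _ <-]|N iN NM].
- by rewrite /= in_fset1 => /eqP->.
- by rewrite fsub1set in_fset1 => /eqP->.
have [x Nx _] := (infinite_natP N).1 iN 0.
have [|n] := @mem_least (fun x => `[< N x >]) x; first exact/asboolP.
move=> /asboolP Nn nmin; exists [fset n]%fset; first by exists n => //; apply: NM.
split=> [y|y z] /=; rewrite !in_fset1 => /eqP->// Ny ny.
by rewrite eqn_leq ny nmin //; apply/asboolP.
Qed.

Lemma uniform_barrierW M B : uniform_barrier M B -> barrier M B.
Proof. by case=> {M B} [M iM|M iM|//]; [apply: barrier_fset0|apply: barrier_fset1]. Qed.

Lemma barrier_nfset0 M B : barrier M B -> B <> [set fset0] -> ~ B fset0.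
Proof.
move=> [_ _ thin _] nB B0; apply: nB; apply/seteqP; split=> [t Bt|_ ->//].
by rewrite /= -(thin fset0 t).
Qed.

(** For [n] in [M], the part of [M] from [n] on has an initial segment in [B]; it is nonempty, so it
    starts with [n]. *)
Lemma barrier_min_at M B n : barrier M B -> B <> [set fset0] ->
  min_at B n !=set0 <-> M n.
Proof.
move=> bB nB; have [iM BM _ bar] := bB; split.
  by move=> [t [Bt [nt _]]]; apply: (BM t).
move=> Mn; have [||s Bs [sN hs]] := bar [set x | M x /\ n <= x].
- apply/infinite_natP => k.
  have [x Mx] := (infinite_natP M).1 iM (maxn k n).
  by rewrite gtn_max => /andP[kx nx]; exists x => //; split=> //; apply: ltnW.
- by move=> x [].
exists s; split=> //; have /is_min_ex[m [ms mmin]] : s != fset0.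
  by apply/eqP => s0; apply: (barrier_nfset0 bB nB); rewrite -s0.
have ns : n \in s by apply: (hs _ m) => //; case: (sN m ms).
by split=> // x /sN[].
Qed.

Lemma barrier_nonempty M B : barrier M B -> exists t, B t.
Proof. by move=> [iM _ _ bar]; have [//|t Bt _] := bar M iM; exists t. Qed.

Lemma rank_fset0 z : ~ olt z (rank [set fset0]).
Proof.
have w s : Acc (below (tree [set fset0])) s.
  apply: (@barrier_wf setT); apply: barrier_fset0; exact: infinite_nat.
move=> /(olt_node_rank (w _))[t [[u -> [tu _]] _ t0] _]; apply: t0.
by apply/fsetP => x; apply/idP/idP => // /tu.
Qed.

Lemma rank_deriv_lt M M' B n : barrier M B -> B <> [set fset0] ->
  barrier M' (deriv B n) -> M n -> olt (rank (deriv B n)) (rank B).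
Proof.
move=> bB nB bD Mn; apply/(olt_node_rank (barrier_wf _ bB)).
exists [fset n]%fset; last by case: (rank_deriv bB bD).
have /(barrier_min_at _ bB nB)[t [Bt [nt tn]]] := Mn.
split.
- exists t => //; split=> [x|x y] /=; rewrite in_fset1 => /eqP->//.
  by move=> xt xn; rewrite in_fset1 eqn_leq xn tn.
- by split=> x.
- by move=> /fsetP/(_ n); rewrite in_fset1 eqxx.
Qed.

Lemma deriv_fset1 (M : set nat) n :
  M n -> deriv [set [fset m]%fset | m in M] n = [set fset0].
Proof.
move=> Mn; have d0 : ([fset n] `\ n)%fset = fset0 :> {fset nat} by rewrite fsetDv.
apply/seteqP; split=> [_ [_ [[m _ <-] [+ _]] <-]|_ ->] /=.
  by rewrite in_fset1 => /eqP <-.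
exists [fset n]%fset => //; split; first by exists n.
by split=> [|m]; rewrite in_fset1 // => /eqP->.
Qed.

Lemma fset1_neq0 (M : set nat) : infinite_set M ->
  [set [fset n]%fset | n in M] <> [set fset0 : {fset nat}].
Proof.
move=> /infinite_natP/(_ 0)[x Mx _] /seteqP[/(_ [fset x]%fset) + _].
by move=> /(_ (ex_intro2 _ _ x Mx erefl))/fsetP/(_ x); rewrite in_fset1 eqxx.
Qed.

(** The rank 1 case joins the inductive step, because the barriers derived from the singletons are
    [[set fset0]]. *)
Lemma uniform_barrier_deriv_ind (P : set nat -> fsfamily -> Prop) :
    (forall M, infinite_set M -> P M [set fset0]) ->
    (forall M B, uniform_barrier M B -> B <> [set fset0] ->
      (forall n, M n -> uniform_barrier (tail M n) (deriv B n)) ->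
      (forall n, M n -> P (tail M n) (deriv B n)) -> P M B) ->
  forall M B, uniform_barrier M B -> P M B.
Proof.
move=> P0 PS M B; elim=> {M B} [//|M iM|M B bB rB uD PD rk].
- apply: PS => [||n Mn|n Mn]; first exact: uniform_rank1; first exact: fset1_neq0.
  + by rewrite deriv_fset1 //; apply: uniform_rank0; apply: infinite_tail.
  + by rewrite deriv_fset1 //; apply: P0; apply: infinite_tail.
- apply: PS => //; first exact: uniform_step.
  by move=> B0; rewrite B0 in rB; apply: rank_fset0 rB.
Qed.

Lemma uniform_deriv M B n : uniform_barrier M B -> B <> [set fset0] -> M n ->
  uniform_barrier (tail M n) (deriv B n).
Proof.
move=> uB; move: uB n.
by move: M B; apply: uniform_barrier_deriv_ind => // M B uB _ uD _ n _; apply: uD.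
Qed.

(** At successor rank every derived barrier has the predecessor as its rank. At limit rank the
    derived ranks increase cofinally, so [m0] is a point where they exceed [a]. *)
Lemma uniform_rank_deriv M B a : uniform_barrier M B -> B <> [set fset0] ->
    olt a (rank B) ->
  exists m0, forall m, M m -> m0 <= m -> ole a (rank (deriv B m)).
Proof.
move=> uB nB aB; have bB := uniform_barrierW uB.
suff [m0 h] : exists m0, forall m, M m -> m0 <= m ->
    ole a (node_rank (tree B) [fset m]%fset).
  exists m0 => m Mm m0m; apply: ole_trans (h m Mm m0m) _.
  by case: (rank_deriv bB (uniform_barrierW (uniform_deriv uB nB Mm))).
case: uB bB nB aB => {M B} [M iM _ //|M iM bB _|M B _ _ _ [[b rB r]|[_ [inc _ cof]]] bB _].
- move=> /(olt_node_rank (barrier_wf _ bB))[t [[_ [n Mn <-] [tn _]] _ t0] at_].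
  have {}tn : t = [fset n]%fset.
    apply/eqP; rewrite eqEfsubset; apply/andP; split; first exact/fsubsetP.
    have /fset0Pn[x xt] : t != fset0 by apply/eqP => e; apply: t0.
    by rewrite fsub1set; have /= := tn x xt; rewrite in_fset1 => /eqP <-.
  (* The node [[fset n]] is a leaf, so its rank is zero and at most that of any [[fset m]]. *)
  exists 0 => m Mm _; apply: ole_trans at_ _; rewrite tn; apply: oleP => z.
  move=> /(olt_node_rank (barrier_wf _ bB))[u [[_ [k Mk <-] [uk _]] [nu _] nu'] _].
  exfalso; apply: nu'; apply/fsetP => x; rewrite in_fset1.
  have nku : n = k.
    have /uk : n \in u by apply: nu; rewrite /= in_fset1.
    by rewrite /= in_fset1 => /eqP.
  apply/eqP/idP => [->|/uk]; last by rewrite /= in_fset1 -nku => /eqP.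
  by apply: nu; rewrite /= in_fset1.
- move=> /olt_ole_trans/(_ rB.1)/olt_succ ab; exists 0 => m Mm _.
  by apply: ole_trans ab _; case: (r m Mm).
- move=> /cof[n Mn an]; exists n => m Mm; rewrite leq_eqVlt => /orP[/eqP<-|nm].
    exact: olt_ole.
  exact: ole_trans (olt_ole an) (olt_ole (inc _ _ Mn Mm nm)).
Qed.

(** * The recursion for [FIN] and the ideal properties *)

Lemma is_FIN_inv B I : is_FIN B I ->
  (B = [set fset0] /\ I = [set set0]) \/
  (B <> [set fset0] /\ exists2 J,
     (forall n, min_at B n !=set0 -> is_FIN (deriv B n) (J n)) &
     I = [set X | X `<=` B /\ finite_set
       [set n | min_at B n !=set0 /\ ~ J n (del n (X `&` min_at B n))]]).
Proof. by case=> {B I} [|B J nB HJ]; [left|right; split=> //; exists J]. Qed.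

(** The recursion determines [J n] only where [min_at B n] is nonempty, but the resulting ideal
    consults no other [n]. *)
Lemma is_FIN_uniq B I I' : is_FIN B I -> is_FIN B I' -> I = I'.
Proof.
move=> h; elim: h I' => {B I} [|B J nB HJ IH] I' /is_FIN_inv[[B0 ->]|[nB' [J' HJ' ->]]] //.
apply/seteqP; split=> X [XB fX]; split=> //; apply: sub_finite_set fX => n [Bn nJ];
  by split=> //; rewrite ?(IH n Bn _ (HJ' n Bn)) // -(IH n Bn _ (HJ' n Bn)).
Qed.

Lemma FIN_is_FIN B I : is_FIN B I -> FIN B = I.
Proof.
move=> h; apply/seteqP; split=> [X [I' h' IX]|X IX]; last by exists I.
by rewrite (is_FIN_uniq h h').
Qed.

Lemma FIN_fset0 : FIN [set fset0] = [set set0].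
Proof. exact: FIN_is_FIN is_FIN0. Qed.

(** Existence for the recursion: the ideals [FIN (deriv B n)] serve as the [J n], and uniqueness
    identifies the result with [FIN B]. *)
Lemma is_FIN_FIN M B : uniform_barrier M B -> is_FIN B (FIN B).
Proof.
move: M B; apply: uniform_barrier_deriv_ind => [M _|M B uB nB uD IH].
  by rewrite FIN_fset0; apply: is_FIN0.
have H n : min_at B n !=set0 -> is_FIN (deriv B n) (FIN (deriv B n)).
  by move=> /(barrier_min_at _ (uniform_barrierW uB) nB)/IH.
by have h := is_FIN_step nB H; rewrite (FIN_is_FIN h).
Qed.

Lemma FIN_step M B X : uniform_barrier M B -> B <> [set fset0] ->
  FIN B X <-> X `<=` B /\
    finite_set [set n | M n /\ ~ FIN (deriv B n) (del n (X `&` min_at B n))].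
Proof.
move=> uB nB; have mB n := barrier_min_at n (uniform_barrierW uB) nB.
have H n : min_at B n !=set0 -> is_FIN (deriv B n) (FIN (deriv B n)).
  by move=> /mB Mn; apply: is_FIN_FIN (uniform_deriv uB nB Mn).
rewrite (FIN_is_FIN (is_FIN_step nB H)); split=> -[XB fX]; split=> //;
  by apply: sub_finite_set fX => n [/mB Mn nF].
Qed.

Lemma FIN_set0 M B : uniform_barrier M B -> FIN B set0.
Proof.
move: M B; apply: uniform_barrier_deriv_ind => [M _|M B uB nB uD IH].
  by rewrite FIN_fset0.
apply/(FIN_step _ uB nB); split=> //; apply: (@sub_finite_set _ _ set0) => //.
move=> n [Mn]; apply; rewrite set0I /del image_set0; exact: IH.
Qed.

Lemma FIN_sub M B X Y : uniform_barrier M B -> X `<=` Y -> FIN B Y -> FIN B X.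
Proof.
move=> uB; move: M B uB X Y.
apply: uniform_barrier_deriv_ind => [M _|M B uB nB uD IH] X Y XY.
  by rewrite FIN_fset0 /= => Y0; move: XY; rewrite Y0 subset0.
move=> /(FIN_step _ uB nB)[YB fY]; apply/(FIN_step _ uB nB).
split; first exact: subset_trans YB.
apply: sub_finite_set fY => n [Mn nF]; split=> // FY; apply: nF.
by apply: IH Mn _ _ _ FY; apply: image_subset; apply: setSI.
Qed.

Lemma FIN_setU M B X Y : uniform_barrier M B ->
  FIN B X -> FIN B Y -> FIN B (X `|` Y).
Proof.
move=> uB; move: M B uB X Y.
apply: uniform_barrier_deriv_ind => [M _|M B uB nB uD IH] X Y.
  by rewrite FIN_fset0 /= => -> ->; rewrite setU0.
move=> /(FIN_step _ uB nB)[XB fX] /(FIN_step _ uB nB)[YB fY].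
apply/(FIN_step _ uB nB); split; first by rewrite subUset.
have : finite_set ([set n | M n /\ ~ FIN (deriv B n) (del n (X `&` min_at B n))] `|`
  [set n | M n /\ ~ FIN (deriv B n) (del n (Y `&` min_at B n))]).
  by rewrite finite_setU.
apply: sub_finite_set => n [Mn nF]; apply: contrapT => /not_orP[nX nY]; apply: nF.
rewrite setIUl /del image_setU; apply: IH => //; apply: contrapT => nF.
  by apply: nX.
by apply: nY.
Qed.

Lemma FIN_bigcup M B (I : eqType) (l : seq I) (F : I -> fsfamily) :
    uniform_barrier M B -> (forall i, i \in l -> FIN B (F i)) ->
  FIN B [set t | exists2 i, i \in l & F i t].
Proof.
move=> uB; elim: l => [_|i l IH Fl].
  by apply: (FIN_sub uB _ (FIN_set0 uB)) => t [].
have : FIN B (F i `|` [set t | exists2 i, i \in l & F i t]).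
  apply: (FIN_setU uB); first by apply: Fl; rewrite inE eqxx.
  by apply: IH => j jl; apply: Fl; rewrite inE jl orbT.
apply: (FIN_sub uB) => t [j]; rewrite inE => /orP[/eqP->|jl] Ft; first by left.
by right; exists j.
Qed.

(** Only the index [n] can be exceptional, since the sections of [X] at other indices are empty. *)
Lemma FIN_min_at M B n X : uniform_barrier M B -> B <> [set fset0] ->
  X `<=` min_at B n -> FIN B X.
Proof.
move=> uB nB XB; apply/(FIN_step _ uB nB); split; first by move=> t /XB[].
apply: (@sub_finite_set _ _ [set n]) => // m [Mm nF].
apply: contrapT => mn; apply: nF.
suff -> : X `&` min_at B m = set0.
  by rewrite /del image_set0; apply: FIN_set0 (uniform_deriv uB nB Mm).
by rewrite -subset0 => t [/XB[_ tn] [_ tm]]; apply: mn; apply: is_min_uniq tm tn.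
Qed.

Lemma FIN_eventually M B X m0 : uniform_barrier M B -> B <> [set fset0] ->
    X `<=` B ->
    (forall m, M m -> m0 <= m -> FIN (deriv B m) (del m (X `&` min_at B m))) ->
  FIN B X.
Proof.
move=> uB nB XB FX; apply/(FIN_step _ uB nB); split=> //.
apply: (@sub_finite_set _ _ `I_m0); last exact: finite_II.
by move=> m [Mm nF] /=; rewrite ltnNge; apply/negP => /(FX m Mm).
Qed.

(** * Small images when the target has larger rank *)

Lemma cone_cone B s s' X Y :
  initseg [set` s] [set` s'] -> (forall x, x \in s' -> x \in s \/ Y x) ->
  X `<=` Y -> cone B s' X `<=` cone B s Y.
Proof.
move=> ss s'Y XY t [Bt st tX]; split=> //; first exact: initseg_trans ss st.
by move=> x /tX[/s'Y//|/XY]; right.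
Qed.

(** Induction on [C] with [B] fixed: instead of passing to smaller barriers one passes to longer
    nodes [s], whose ranks drop. Density, rather than mere existence, lets the shrinkings be
    fused. *)
Lemma FIN_image_dense M0 B N C s (f : {fset nat} -> {fset nat}) :
    barrier M0 B -> uniform_barrier N C -> tree B s ->
    olt (node_rank (tree B) s) (rank C) -> (forall t, cone B s setT t -> C (f t)) ->
  dense (fun X => FIN C (f @` cone B s X)).
Proof.
move=> bB uC; move: N C uC s f.
apply: uniform_barrier_deriv_ind => [N _ s f _ /rank_fset0//|N C uC nC uD IH s f Ts sC fC].
move=> M iM; have [m0 m0P] := uniform_rank_deriv uC nC sC.
have fsub X : f @` cone B s X `<=` C.
  by move=> _ [t /(cone_sub (@subsetT _ X)) /fC ? <-].
pose A X m := (forall t, cone B s X t -> is_min (f t) m) \/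
              (forall t, cone B s X t -> ~ is_min (f t) m).
(* The image above a longer node [s'] has a small section at [m]; the guards make this vacuous,
   hence dense, for all other [s'] and [m]. *)
pose D s' m X := N m -> m0 <= m -> tree B s' -> initseg [set` s] [set` s'] ->
  s' <> s -> FIN (deriv C m) (del m (f @` cone B s' X `&` min_at C m)).
have imsub s' X Y m : X `<=` Y -> del m (f @` cone B s' X `&` min_at C m) `<=`
    del m (f @` cone B s' Y `&` min_at C m).
  move=> XY; apply: image_subset; apply: setSI; apply: image_subset.
  exact: cone_sub.
have herA m : hereditary (A ^~ m).
  by move=> X Y XY [] H; [left|right] => t /(cone_sub XY)/H.
have herD s' m : hereditary (D s' m).
  move=> X Y XY H Nm m0m Ts' ss' ns'.
  exact: FIN_sub (uD m Nm) (imsub _ _ _ _ XY) (H Nm m0m Ts' ss' ns').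
have denA m : dense (A ^~ m) by apply: nash_williams bB.
have denD s' m : dense (D s' m).
  move=> K iK.
  have [hyp|nhyp] := pselect ([/\ N m, m0 <= m, tree B s',
     initseg [set` s] [set` s'] & s' <> s]); last first.
    by exists K; split=> // Nm m0m Ts' ss' ns'; case: nhyp; split.
  case: hyp => Nm m0m Ts' ss' ns'.
  have [c0 c0P] := barrier_nonempty (uniform_barrierW (uD m Nm)).
  (* The default [c0] keeps the values in [deriv C m] where the minimum of [f t] is not [m]. *)
  pose f' t := if pselect (is_min (f t) m) then (f t `\ m)%fset else c0.
  have [||X [iX XK FX]] := IH m Nm s' f' Ts' _ _ K iK.
  (* The rank of [s'] is below that of [s], which by the choice of [m0] is at most the rank of
     [deriv C m]. *)
  - apply: olt_ole_trans (m0P m Nm m0m).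
    apply/(olt_node_rank (barrier_wf _ bB)); exists s'; last exact: ole_refl.
    by split=> // e; apply: ns'.
  - move=> t ts'; rewrite /f'; case: pselect => //= fm; exists (f t) => //.
    by split=> //; apply: fC; apply: cone_cone ts' => // x _; right.
  exists X; split=> // _ _ _ _ _; apply: FIN_sub (uD m Nm) _ FX.
  move=> _ [_ [[t tX <-] [_ fm]] <-]; exists t => //.
  by rewrite /f'; case: pselect.
(* At stage [k] only indices [m <= k] and stems enlarged by subsets of [[0, k]] are treated, so the
   requirements are finitely many. *)
pose I k := fpowerset [fset x in iota 0 k.+1]%fset.
pose R k X := (forall m, m \in iota 0 k.+1 -> A X m) /\
  (forall p, p \in [seq (m, u) | m <- iota 0 k.+1, u <- enum_fset (I k)] ->
      D (s `|` p.2)%fset p.1 X).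
have herR k : hereditary (R k).
  move=> X Y XY [RA RD]; split=> [m /RA|p /RD]; first exact: herA.
  exact: herD.
have denR k : dense (R k).
  move=> K iK.
  have [X [iX XK XA]] :=
    dense_seq (l := iota 0 k.+1) herA (fun m _ => denA m) iK.
  have [Y [iY YX YD]] :=
    dense_seq (l := [seq (m, u) | m <- iota 0 k.+1, u <- enum_fset (I k)])
      (fun p => herD (s `|` p.2)%fset p.1)
      (fun p _ => denD (s `|` p.2)%fset p.1) iX.
  exists Y; split=> //; first exact: subset_trans XK.
  by split=> // m /XA; apply: herA.
have [X [iX XM RX]] := fusion herR denR iM.
(* If a single minimum [m] occurs throughout some tail, the image of that tail lies in [min_at C m]
   and is small. *)
have [[m [k [Xk km]]]|nhom] := pselect (exists m k, X k /\
    forall t, cone B s (tail X k) t -> is_min (f t) m).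
  exists (tail X k); split; [exact: infinite_tail|by move=> x []; auto|].
  apply: (FIN_min_at uC nC (n := m)) => _ [t tX <-]; split; last exact: km.
  by apply: (fsub (tail X k)); exists t.
exists X; split=> //; apply: (FIN_eventually uC nC (fsub X) (m0 := m0)) => m Nm m0m.
have [k Xk mk] := (infinite_natP X).1 iX m.
have [RA RD] := RX k Xk.
have mI : m \in iota 0 k.+1 by rewrite mem_iota ltnS (ltnW mk).
have nA t : cone B s (tail X k) t -> ~ is_min (f t) m.
  case: (RA m mI) => [H|H]; [case: nhom; exists m, k|]; auto.
(* The section contributed by the stem enlarged by [u], made empty when that stem is not a proper
   extension of [s] in the tree. *)
pose F u := [set t | [/\ tree B (s `|` u)%fset,
  initseg [set` s] [set` (s `|` u)%fset], (s `|` u)%fset <> s &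
  del m (f @` cone B (s `|` u)%fset (tail X k) `&` min_at C m) t]].
have FF u : u \in enum_fset (I k) -> FIN (deriv C m) (F u).
  move=> uI; have [[Tu su nu]|no] := pselect ([/\ tree B (s `|` u)%fset,
    initseg [set` s] [set` (s `|` u)%fset] & (s `|` u)%fset <> s]).
    have DF : D (s `|` u)%fset m (tail X k).
      by apply: (RD (m, u)); apply/allpairsP; exists (m, u).
    by apply: FIN_sub (uD m Nm) _ (DF Nm m0m Tu su nu) => t [].
  apply: FIN_sub (uD m Nm) _ (FIN_set0 (uD m Nm)) => t [Tu su nu _].
  by case: no; split.
have := FIN_bigcup (uD m Nm) FF.
apply: (FIN_sub (uD m Nm)) => _ [_ [[t tX <-] [Cft ftm]] <-].
have [Bt st tsX] := tX.
(* If this [u] added nothing to [s], then [t] would lie in the cone of [s] over the tail, where [nA]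
   excludes the minimum [m]. *)
have it := initsegU k st; set u := [fset x in t | x <= k]%fset in it.
have tu : cone B (s `|` u)%fset (tail X k) t.
  split=> // x xt; rewrite in_fsetU !inE xt /=.
  have [xs|xs] := boolP (x \in s); first by left.
  have [xk|kx] := leqP x k; first by left.
  by right; split=> //; case: (tsX x xt) => // xs'; rewrite xs' in xs.
exists u.
  rewrite -[_ \in _]/(u \in fpowerset _) fpowersetE; apply/fsubsetP => x.
  move=> xu; have xk : x <= k by move: xu; rewrite !inE => /andP[].
  by rewrite in_fset mem_iota ltnS.
split; [by exists t| | |by exists (f t) => //; split=> //; exists t].
- split=> [x xs|x y ys xsu xy]; first by rewrite /= in_fsetU (xs : x \in s).
  by case: st => _ h; apply: (h _ _ ys) => //; case: it => + _; apply.
- by move=> e; case: (nA t) => //; rewrite -e.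
Qed.

(** * A map without small images when the target has no larger rank *)

(** A small image has boundedly many exceptional indices. Some [n] in [X] has [h n] beyond that
    bound, which contradicts the inductive choice of the map on [deriv B n]. *)
Lemma not_FIN_map N C M B : uniform_barrier N C -> uniform_barrier M B ->
  ole (rank C) (rank B) ->
  exists2 f : {fset nat} -> {fset nat}, set_fun B C f &
    forall X, infinite_set X -> X `<=` M -> ~ FIN C (f @` restr B X).
Proof.
move=> uC; move: N C uC M B.
apply: uniform_barrier_deriv_ind => [N _ M B uB _|N C uC nC uD IH M B uB CB].
  exists (fun=> fset0) => // X iX XM; rewrite FIN_fset0 /= => e.
  have [_ _ _ bar] := uniform_barrierW uB; have [t Bt [tX _]] := bar X iX XM.
  have : ((fun=> fset0 : {fset nat}) @` restr B X) fset0 by exists t.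
  by rewrite e.
have bC := uniform_barrierW uC.
have Dlt m : N m -> olt (rank (deriv C m)) (rank C).
  by move=> Nm; apply: rank_deriv_lt bC nC (uniform_barrierW (uD m Nm)) Nm.
have [c0 c0P] := barrier_nonempty bC.
have nB : B <> [set fset0].
  have [iN _ _ _] := bC; have [m Nm _] := (infinite_natP N).1 iN 0.
  by move=> B0; have := olt_ole_trans (Dlt m Nm) CB; rewrite B0; apply: rank_fset0.
have bB := uniform_barrierW uB.
(* The bound [m <= n] guarantees a largest admissible index, which [h n] will be. *)
pose ok n m := [/\ N m, m <= n & ole (rank (deriv C m)) (rank (deriv B n))].
have /choice[h hP] : forall n, exists m, forall m', ok n m' -> ok n m /\ m' <= m.
  move=> n; have [[m okm]|nok] := pselect (exists m, ok n m); last first.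
    by exists 0 => m' ok'; case: nok; exists m'.
  have ex : exists m, `[< ok n m >] by exists m; apply/asboolP.
  have ub i : `[< ok n i >] -> i <= n by move=> /asboolP[].
  case: (ex_maxnP ex ub) => i /asboolP oki imax; exists i => m' ok'; split=> //.
  by apply: imax; apply/asboolP.
have /choice[F FP] : forall n, exists f : {fset nat} -> {fset nat},
    M n -> ok n (h n) -> set_fun (deriv B n) (deriv C (h n)) f /\
    forall X, infinite_set X -> X `<=` tail M n ->
      ~ FIN (deriv C (h n)) (f @` restr (deriv B n) X).
  move=> n; have [[Mn [Nh _ hn]]|no] := pselect (M n /\ ok n (h n)); last first.
    by exists id => Mn okn; case: no.
  by have [f f1 f2] := IH _ Nh _ _ (uniform_deriv uB nB Mn) hn; exists f.
(* Strip the minimum [n], apply [F n], put [h n] in front. The default [c0] covers a missing minimum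
   or admissible index and keeps [f] inside [C]. *)
pose f t := if pselect (exists n, is_min t n) is left e then
  let n := projT1 (cid e) in
  if pselect (ok n (h n)) then (h n |` F n (t `\ n))%fset else c0 else c0.
have fE t n : is_min t n -> ok n (h n) -> f t = (h n |` F n (t `\ n))%fset.
  move=> tn okn; rewrite /f; case: pselect => [e|/(_ (ex_intro _ n tn))//].
  by case: cid => n' tn' /=; rewrite -(is_min_uniq tn tn'); case: pselect.
have MB t n : B t -> is_min t n -> M n.
  by have [_ BM _ _] := bB; move=> /BM tM [/tM].
exists f => [t Bt|X iX XM].
  rewrite /f; case: pselect => // e; case: cid => n tn /=; case: pselect => //= okn.
  have [fC _] := FP n (MB _ _ Bt tn) okn.
  have /fC/derivP[_ //] : deriv B n (t `\ n)%fset by exists t.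
move=> /(FIN_step _ uC nC)[_ fin].
have iN : infinite_set N by case: bC.
have /infinite_natP : infinite_set (N `\` [set m | N m /\
    ~ FIN (deriv C m) (del m (f @` restr B X `&` min_at C m))]).
  exact: infinite_setD.
set E := [set m | _] in fin *.
have [L LP] : exists L, forall m, E m -> m < L.
  apply: contrapT => /forallNP H; apply: (infinite_natP E).2 fin => k.
  have /existsNP[m /not_implyP[Em mk]] := H k.+1.
  by exists m => //; move: mk => /negP; rewrite -leqNgt.
(* The rank of [deriv C m1] is below that of [B], so [m1] is admissible for all large [n] in [M];
   maximality then puts [h n] at or above [m1], beyond [L]. *)
move=> _; have [m1 Nm1 Lm1] := (infinite_natP N).1 iN L.
have [n0 n0P] := uniform_rank_deriv uB nB (olt_ole_trans (Dlt m1 Nm1) CB).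
have [n Xn] := (infinite_natP X).1 iX (maxn n0 m1); rewrite gtn_max => /andP[n0n m1n].
have Mn := XM _ Xn.
have [okn m1h] : ok n (h n) /\ m1 <= h n.
  by apply: hP; split=> //; [apply: ltnW|apply: n0P => //; apply: ltnW].
have [Nh _ _] := okn; have [fC nF] := FP n Mn okn.
have : ~ E (h n).
  by move=> /LP; rewrite ltnNge (leq_trans (ltnW Lm1) m1h).
apply; split=> // FE.
(* Adding [n] to members of [deriv B n] inside [tail X n] gives members of [restr B X], so their
   images under [F n] lie in the small section at [h n]. *)
apply: (nF (tail X n)) => //; first exact: infinite_tail.
  by move=> x [/XM].
apply: FIN_sub (uD _ Nh) _ FE => _ [t [Dt tX] <-].
have /derivP[nt Bt] := Dt; have [mn tE] := is_min_cons nt.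
have /derivP[hF CF] := fC _ Dt; have [mh FE] := is_min_cons hF.
exists (h n |` F n t)%fset => //; split; last by split.
exists (n |` t)%fset; last by rewrite (fE _ n mn okn) tE.
split=> // x; rewrite /= in_fset1U => /orP[/eqP->//|xt].
by case: (tX x xt).
Qed.

Theorem corollary5p16 (B C : fsfamily)
    (uB : uniform_barrier [set: nat] B) (uC : uniform_barrier [set: nat] C)
    (leBC : ole (rank B) (rank C)) :
  ~ katetov_le C (FIN C) B (Gc B) <-> olt (rank B) (rank C).
Proof.
split=> [nK|ltBC [f fC fK]].
  case: (ole_total (rank C) (rank B)) => // leCB; case: nK.
  (* If [restr B X] lay in the preimage of a small [A], its image would lie in [A] and be small,
     against [fX]. *)
  have [f fC fX] := not_FIN_map uC uB leCB; exists f => // A FA.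
  split=> [|[X iX XA]]; first exact: subIsetl.
  apply: (fX X iX (@subsetT _ X)); apply: FIN_sub uC _ FA.
  by move=> _ [t /XA[_ At] <-].
have bB := uniform_barrierW uB; have [t Bt] := barrier_nonempty bB.
have T0 : tree B fset0 by exists t.
(* At the root the cone is [restr B X]. Its image is small, yet the preimage of that image contains
   all of [restr B X] and so is not in [Gc B]. *)
have [|X [iX _ FX]] := FIN_image_dense bB uC T0 ltBC (f := f) _ infinite_nat.
  by move=> u [Bu _ _]; apply: fC.
have [_] := fK _ FX; apply; exists X => //.
by rewrite cone0 => u [Bu uX]; split=> //; exists u.
Qed.
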